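(* Let $n \ge 7$ and let $\mathcal{L}$ be a generic regular $n$-gon linkage. Then $\mathcal{L}$ is hypo-paradoxical: although the Chebyshev–Grübler–Kutzbach count gives $M(\mathcal{L}) = n-6 > 0$, its configuration space has dimension zero, i.e. the linkage admits no nontrivial continuous motion (it is kinematically locked).
   Context: A closed $n$R kinematic chain consists of $n$ revolute joints, joint $i$ having screw axis $\bm{\xi}_i = (\bm{\omega}_i, \bm{q}_i \times \bm{\omega}_i) \in \mathbb{R}^6$, where $\bm{\omega}_i$ is a unit direction vector of the joint axis and $\bm{q}_i$ a point on it, with associated $4\times 4$ twist matrix $\hat{\bm{\xi}}_i = \begin{bmatrix} [\bm{\omega}_i]_\times & \bm{q}_i \times \bm{\omega}_i \\ 0 & 0\end{bmatrix}$. Its configuration space is $\mathcal{C}(\mathcal{L}) = \{(\theta_1,\dots,\theta_n) : \prod_{i=1}^n e^{\hat{\bm{\xi}}_i\theta_i} = I_4\}$, taken near the reference configuration $\theta = 0$ (the mobility depends only on the screw axes, not on the shape of the links). The Chebyshev–Grübler–Kutzbach mobility of a closed chain of $n$ links and $n$ revolute joints is $M = n-6$. A closed chain $\mathcal{L}$ is hypo-paradoxical if $M(\mathcal{L}) > 0$ but $\dim \mathcal{C}(\mathcal{L}) = 0$ (all admissible configurations are isolated). A regular $n$-gon linkage: choose a unit vector $\bm{\omega}_1$ and a point $\bm{q}_1$ in the $xy$-plane, and set $\bm{\omega}_i = R_z(\alpha_i)\bm{\omega}_1$, $\bm{q}_i = R_z(\alpha_i)\bm{q}_1$ with $\alpha_i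 = 2\pi(i-1)/n$, $i=1,\dots,n$, where $R_z$ is rotation about the $z$-axis; the joints $\bm{q}_i$ (vertices of a regular $n$-gon) are connected cyclically by links. It is generic if (i) $\bm{\omega}_1$ is not parallel to the $z$-axis, and (ii) the axes $\bm{\xi}_1,\dots,\bm{\xi}_n$ do not form a pencil of lines through a common point of the $z$-axis. *)

(* Defs.v *)
From HB Require Import structures.
From mathcomp Require Import all_boot all_order all_algebra.
From mathcomp Require Import all_classical all_reals all_analysis.
Set Implicit Arguments. Unset Strict Implicit. Unset Printing Implicit Defensive.
Import Order.TTheory GRing.Theory Num.Theory.
Import numFieldNormedType.Exports.
Local Open Scope classical_set_scope.
Local Open Scope ring_scope.

Section Defs.
Variable R : realType.

Definition vec3 (a b c : R) : 'cV[R]_3 :=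
  \col_(i < 3) [:: a; b; c]`_i.

Definition e_z : 'cV[R]_3 := vec3 0 0 1.

Definition cross (u v : 'cV[R]_3) : 'cV[R]_3 :=
  vec3 (u 1 0 * v 2 0 - u 2 0 * v 1 0)
       (u 2 0 * v 0 0 - u 0 0 * v 2 0)
       (u 0 0 * v 1 0 - u 1 0 * v 0 0).

(* skew-symmetric matrix [w]_x, so that [w]_x *m v = cross w v *)
Definition skew (w : 'cV[R]_3) : 'M[R]_3 :=
  \matrix_(i < 3, j < 3)
    nth 0 (nth [::] [:: [:: 0; - w 2 0; w 1 0];
        [:: w 2 0; 0; - w 0 0];
        [:: - w 1 0; w 0 0; 0]] i) j.

Definition twist_hat (w v : 'cV[R]_3) : 'M[R]_4 :=
  \matrix_(i < 4, j < 4)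
    if (i < 3)%N then
      (if (j < 3)%N then skew w (inord i) (inord j) else v (inord i) 0)
    else 0.

Definition revolute_twist (w q : 'cV[R]_3) : 'M[R]_4 := twist_hat w (cross q w).

Definition expm (A : 'M[R]_4) : 'M[R]_4 :=
  lim ((fun N : nat => \sum_(k < N) (k`!%:R)^-1 *: A ^+ k) @ \oo).

Definition Rz (a : R) : 'M[R]_3 :=
  \matrix_(i < 3, j < 3)
    nth 0 (nth [::] [:: [:: cos a; - sin a; 0];
        [:: sin a; cos a; 0];
        [:: 0; 0; 1]] i) j.

(* joint angles alpha_i = 2 pi i / n for 0-based i : 'I_n (i.e. 2 pi (i-1)/n, 1-based) *)
Definition alpha (n : nat) (i : 'I_n) : R := 2 * pi * i%:R / n%:R.

Definition omega_i (n : nat) (w1 : 'cV[R]_3) (i : 'I_n) : 'cV[R]_3 := Rz (alpha i) *m w1.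
Definition q_i (n : nat) (q1 : 'cV[R]_3) (i : 'I_n) : 'cV[R]_3 := Rz (alpha i) *m q1.

Definition loop_map (n : nat) (w : 'I_n -> 'cV[R]_3) (q : 'I_n -> 'cV[R]_3)
    (theta : 'I_n -> R) : 'M[R]_4 :=
  \prod_(i < n) expm (theta i *: revolute_twist (w i) (q i)).

Definition config_space (n : nat) (w q : 'I_n -> 'cV[R]_3) : set ('I_n -> R) :=
  [set theta | loop_map w q theta = 1].

Definition CGK_mobility (n : nat) : int := (n%:Z - 6)%R.

(* dim C(L) = 0 near the reference configuration theta = 0:
   theta = 0 is an isolated point of C(L). *)
Definition config_dim_zero (n : nat) (w q : 'I_n -> 'cV[R]_3) : Prop :=
  exists2 e : R, 0 < e &
    forall theta : 'I_n -> R, (forall i, `|theta i| < e) ->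
      theta \in config_space w q -> forall i, theta i = 0.

Definition hypo_paradoxical (n : nat) (w q : 'I_n -> 'cV[R]_3) : Prop :=
  (0 < CGK_mobility n)%R /\ config_dim_zero w q.

Definition regular_ngon_data (w1 q1 : 'cV[R]_3) : Prop :=
  (w1^T *m w1) 0 0 = 1 /\ q1 2 0 = 0.

(* genericity: (i) w1 not parallel to the z-axis;
   (ii) the axes do not all pass through a common point of the z-axis *)
Definition generic_ngon (n : nat) (w1 q1 : 'cV[R]_3) : Prop :=
  cross w1 e_z != 0 /\
  ~ (exists c : R, forall i : 'I_n,
        cross (vec3 0 0 c - q_i q1 i) (omega_i w1 i) = 0).

End Defs.

(* Main.v *)
(* Write s_i = sin theta_i.  All axes are images of one axis under rotations about the z-axis,
   so to second order in s the closure equation only involves sigma = sum_i s_i, the plane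
   vector Z = sum_i s_i e^(i alpha_i), and A = sum_(i<j) s_i s_j sin (alpha_j - alpha_i), which
   is twice the signed area of the polygon with edges s_i e^(i alpha_i).  The first order gives
   Z = O(|s|^2).  The z-components of the equation form a linear system in (sigma, A), up to
   O(|s|^3), whose determinant is nonzero precisely because the axes do not meet on the z-axis;
   hence sigma and A are O(|s|^3).  But on closed polygons of zero signed perimeter
   (Z = 0, sigma = 0) the area is negative definite: this is the
   isoperimetric inequality for equiangular polygons, proved by discrete Fourier analysis.
   So |s|^2 = O(|s|^3), and s = 0 near the reference configuration. *)
Require Import Defs.
From HB Require Import structures.
From mathcomp Require Import all_boot all_order all_algebra.
From mathcomp Require Import all_classical all_reals all_analysis.
From mathcomp Require Import ring lra zify.
Import Order.TTheory GRing.Theory Num.Theory.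
Import numFieldNormedType.Exports.
Local Open Scope ring_scope.

(** * Discrete Fourier analysis and the isoperimetric inequality for equiangular polygons *)

Section DiscreteFourier.
Variable R : realType.
Implicit Types (n k m : nat) (f g x : nat -> R) (a phi : R).

(** The sum telescopes, because [2 sin (a/2) cos x = sin (x + a/2) - sin (x - a/2)]. *)
Lemma sin_half_sum_cos n a phi :
  2 * sin (a / 2) * \sum_(k < n) cos (k%:R * a + phi) =
  sin (n%:R * a - a / 2 + phi) - sin (phi - a / 2).
Proof.
elim: n => [|n IHn]; first by rewrite big_ord0 mulr0 mul0r sub0r [- _ + _]addrC subrr.
rewrite big_ord_recr /= mulrDr IHn.
have -> : n.+1%:R * a - a / 2 + phi = (n%:R * a + phi) + a / 2.
  by rewrite -natr1; field.
have -> : n%:R * a - a / 2 + phi = (n%:R * a + phi) - a / 2 by ring.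
rewrite !(sinD (n%:R * a + phi)) cosN sinN; ring.
Qed.

Definition step n : R := 2 * pi / n%:R.

Lemma sum_cos_root_of_unity n m phi : (0 < m < n)%N ->
  \sum_(k < n) cos (k%:R * (m%:R * step n) + phi) = 0.
Proof.
move=> /andP[m0 mn].
have n0 : 0 < n%:R :> R by rewrite ltr0n; lia.
have := sin_half_sum_cos n (m%:R * step n) phi.
(* The two ends of the telescoped sum differ by [m] full turns, so they cancel; the remaining factor
   [sin (m pi / n)] is nonzero for [0 < m < n]. *)
have -> : n%:R * (m%:R * step n) - m%:R * step n / 2 + phi =
    (phi - m%:R * step n / 2) + (pi *+ 2) *+ m.
  rewrite -[_ *+ m]mulr_natl -[pi *+ 2]mulr_natl /step; field.
  by rewrite gt_eqF.
rewrite periodicn; last exact: sinD2pi.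
rewrite subrr => /eqP; rewrite !mulf_eq0 pnatr_eq0 /= => /orP[/eqP s0|/eqP //].
suff : 0 < sin (m%:R * step n / 2) by rewrite s0 ltxx.
have -> : m%:R * step n / 2 = pi * (m%:R / n%:R).
  by rewrite /step; field; rewrite gt_eqF.
apply: sin_gt0_pi; rewrite mulr_gt0 ?pi_gt0 ?divr_gt0 ?(ltr0n _ m) //=.
by rewrite gtr_pMr ?pi_gt0// ltr_pdivrMr// mul1r ltr_nat.
Qed.

Lemma sum_cos_root_of_unity0 n m : (0 < m < n)%N ->
  \sum_(k < n) cos (k%:R * (m%:R * step n)) = 0.
Proof.
move=> mn; rewrite -[RHS](@sum_cos_root_of_unity n m 0 mn).
by apply: eq_bigr => k _; rewrite addr0.
Qed.

Lemma sum_sin_root_of_unity0 n m : (0 < m < n)%N ->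
  \sum_(k < n) sin (k%:R * (m%:R * step n)) = 0.
Proof.
move=> mn; rewrite -[RHS](@sum_cos_root_of_unity n m (- (pi / 2)) mn).
by apply: eq_bigr => k _; rewrite cosBpihalf.
Qed.

Definition cosT n f k := \sum_(j < n) f j * cos (k%:R * (j%:R * step n)).
Definition sinT n f k := \sum_(j < n) f j * sin (k%:R * (j%:R * step n)).

(** Bilinear rather than quadratic, since the area form pairs [f] with its support numbers. The left
    side is a double sum of [f i g j cos (k (i - j) step)], and summing over [k] kills every
    off-diagonal term. *)
Lemma parseval n f g :
  \sum_(k < n) (cosT n f k * cosT n g k + sinT n f k * sinT n g k) =
  n%:R * \sum_(j < n) f j * g j.
Proof.
transitivity (\sum_(i < n) \sum_(j < n) f i * g j *
    \sum_(k < n) cos (k%:R * (i%:R * step n) - k%:R * (j%:R * step n))).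
  under [RHS]eq_bigr do under eq_bigr do rewrite mulr_sumr.
  under [RHS]eq_bigr do rewrite exchange_big /=.
  rewrite [RHS]exchange_big /=; apply: eq_bigr => k _.
  rewrite /cosT /sinT !mulr_suml -big_split /=; apply: eq_bigr => i _.
  rewrite !mulr_sumr -big_split /=; apply: eq_bigr => j _.
  rewrite cosB; ring.
rewrite mulr_sumr; apply: eq_bigr => i _.
rewrite (bigD1 i) //= [X in _ + X]big1 => [|j ji].
  rewrite addr0 (eq_bigr (fun=> 1)) => [|k _]; last by rewrite subrr cos0.
  by rewrite sumr_const card_ord mulrC.
have [ltij|ltji|/val_inj eij] := ltngtP i j; last by rewrite eij eqxx in ji.
- rewrite (eq_bigr (fun k : 'I_n => cos (k%:R * ((j - i)%N%:R * step n)))).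
    by rewrite sum_cos_root_of_unity0 ?mulr0// subn_gt0 ltij /=; case: j {ji} ltij => /= *; lia.
  by move=> k _; rewrite -cosN natrB ?(ltnW ltij)//; congr cos; ring.
- rewrite (eq_bigr (fun k : 'I_n => cos (k%:R * ((i - j)%N%:R * step n)))).
    by rewrite sum_cos_root_of_unity0 ?mulr0// subn_gt0 ltji /=; case: i {ji} ltji => /= *; lia.
  by move=> k _; rewrite natrB ?(ltnW ltji)//; congr cos; ring.
Qed.

(* Signed distance from the origin to the line carrying the [j]-th edge of the polygonal
   path with edge vectors [f i * (cos (i d), sin (i d))]. *)
Definition support_number (d : R) f j := \sum_(i < j) f i * sin ((j%:R - i%:R) * d).

(** Discrete form of [h'' + h = rho], which relates the support function of a convex curve to its
    radius of curvature. *)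
Lemma support_number_rec d f j :
  support_number d f j.+2 =
  2 * cos d * support_number d f j.+1 - support_number d f j + sin d * f j.+1.
Proof.
rewrite /support_number big_ord_recr /= [in LHS]big_ord_recr /=.
rewrite [in X in _ * X - _]big_ord_recr /=.
have -> : \sum_(i < j) f i * sin ((j.+2%:R - i%:R) * d) =
    2 * cos d * (\sum_(i < j) f i * sin ((j.+1%:R - i%:R) * d)) -
    \sum_(i < j) f i * sin ((j%:R - i%:R) * d).
  rewrite mulr_sumr -sumrB; apply: eq_bigr => i _.
  have -> : (j.+2%:R - i%:R) * d = (j.+1%:R - i%:R) * d + d.
    by rewrite -(natr1 j.+1); ring.
  have -> : (j%:R - i%:R) * d = (j.+1%:R - i%:R) * d - d.
    by rewrite -(natr1 j); ring.
  rewrite sinD sinB; ring.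
have -> : (j.+2%:R - j%:R) * d = d + d by rewrite -(natr1 j.+1) -(natr1 j); ring.
have -> : (j.+1%:R - j%:R) * d = d by rewrite -(natr1 j); ring.
have -> : (j.+2%:R - j.+1%:R) * d = d by rewrite -(natr1 j.+1); ring.
rewrite sinD; ring.
Qed.

(** Summation by parts: [x] is an eigenvector, with eigenvalue [2 (c - cos d)], of the symmetric
    operator sending [h] to [h (j+1) + h (j-1) - 2 cos d h j], and this operator turns support
    numbers into [sin d] times edge lengths. Only boundary terms survive. *)
Lemma support_number_by_parts d c f x N :
  (forall j, x j.+2 + x j = 2 * c * x j.+1) ->
  sin d * (\sum_(j < N.+1) f j * x j) -
    2 * (c - cos d) * (\sum_(j < N.+1) support_number d f j * x j) =
  x N * support_number d f N.+1 - x N.+1 * support_number d f N.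
Proof.
move=> xrec; elim: N => [|N IHN].
  rewrite !big_ord1 /support_number big_ord0 big_ord1 /= subr0 mul1r; ring.
rewrite big_ord_recr /= [in X in _ - X]big_ord_recr /=.
rewrite support_number_rec.
have -> : x N.+2 = 2 * c * x N.+1 - x N by rewrite -xrec addrK.
move: IHN; set F := \sum_(_ < _) _; set G := \sum_(_ < _) _ => IHN.
move/eqP: IHN; rewrite subr_eq => /eqP IHN; rewrite mulrDr IHN; ring.
Qed.

Lemma step_turn n : (0 < n)%N -> n%:R * step n = pi *+ 2.
Proof.
move=> n0; rewrite /step -[pi *+ 2]mulr_natl; field.
by rewrite pnatr_eq0; lia.
Qed.

Section ClosedPath.
Variables (N : nat) (f : nat -> R).
Let n := N.+1.
Let d := step n.
Hypothesis cosT1 : cosT n f 1 = 0.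
Hypothesis sinT1 : sinT n f 1 = 0.

Lemma sum_sin_closed phi : \sum_(i < n) f i * sin (phi - i%:R * d) = 0.
Proof.
transitivity (sin phi * cosT n f 1 - cos phi * sinT n f 1); last first.
  by rewrite cosT1 sinT1 !mulr0 subrr.
rewrite /cosT /sinT !mulr_sumr -sumrB; apply: eq_bigr => i _.
rewrite sinB !mul1r; ring.
Qed.

Lemma support_number_last : support_number d f n = 0.
Proof.
rewrite -[RHS](sum_sin_closed (n%:R * d)); apply: eq_bigr => i _.
by rewrite mulrBl.
Qed.

Lemma support_number_penultimate : support_number d f N = 0.
Proof.
(* The term [i = N], which the support number lacks, carries the factor [sin 0]. *)
rewrite -[RHS](sum_sin_closed (N%:R * d)) big_ord_recr /= subrr sin0 mulr0 addr0.
by apply: eq_bigr => i _; rewrite mulrBl.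
Qed.

(** Closedness of the path kills the boundary terms of the summation by parts, so edges and support
    numbers are related by a Fourier multiplier. *)
Lemma cosT_support_number k :
  sin d * cosT n f k = 2 * (cos (k%:R * d) - cos d) * cosT n (support_number d f) k.
Proof.
have := @support_number_by_parts d (cos (k%:R * d)) f (fun j => cos (k%:R * (j%:R * d))) N.
rewrite support_number_last support_number_penultimate !mulr0 subrr => /(_ _)/eqP.
rewrite subr_eq0 => H; apply/eqP/H => j.
have -> : k%:R * (j.+2%:R * d) = k%:R * (j.+1%:R * d) + k%:R * d.
  by rewrite -(natr1 j.+1); ring.
have -> : k%:R * (j%:R * d) = k%:R * (j.+1%:R * d) - k%:R * d.
  by rewrite -(natr1 j); ring.
rewrite cosD cosB; ring.
Qed.

Lemma sinT_support_number k :
  sin d * sinT n f k = 2 * (cos (k%:R * d) - cos d) * sinT n (support_number d f) k.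
Proof.
have := @support_number_by_parts d (cos (k%:R * d)) f (fun j => sin (k%:R * (j%:R * d))) N.
rewrite support_number_last support_number_penultimate !mulr0 subrr => /(_ _)/eqP.
rewrite subr_eq0 => H; apply/eqP/H => j.
have -> : k%:R * (j.+2%:R * d) = k%:R * (j.+1%:R * d) + k%:R * d.
  by rewrite -(natr1 j.+1); ring.
have -> : k%:R * (j%:R * d) = k%:R * (j.+1%:R * d) - k%:R * d.
  by rewrite -(natr1 j); ring.
rewrite sinD sinB; ring.
Qed.

(** Since [f] is real, mode [n - 1] is the complex conjugate of mode [1]. *)
Lemma cosT_symm : cosT n f N = cosT n f 1.
Proof.
apply: eq_bigr => j _; congr (_ * _).
have -> : N%:R * (j%:R * step n) = - (1 * (j%:R * step n)) + (pi *+ 2) *+ j.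
  by rewrite -(@step_turn n)// -[_ *+ j]mulr_natl /n -(natr1 N); ring.
by rewrite periodicn ?cosN//; exact: cosD2pi.
Qed.

Lemma sinT_symm : sinT n f N = - sinT n f 1.
Proof.
rewrite /sinT -sumrN; apply: eq_bigr => j _; rewrite -mulrN; congr (_ * _).
have -> : N%:R * (j%:R * step n) = - (1 * (j%:R * step n)) + (pi *+ 2) *+ j.
  by rewrite -(@step_turn n)// -[_ *+ j]mulr_natl /n -(natr1 N); ring.
by rewrite periodicn ?sinN//; exact: sinD2pi.
Qed.

End ClosedPath.

Lemma step_gt0 n : (0 < n)%N -> 0 < step n.
Proof. by move=> n0; rewrite divr_gt0 ?mulr_gt0 ?pi_gt0 ?ltr0n. Qed.

Lemma sin_step_gt0 n : (2 < n)%N -> 0 < sin (step n).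
Proof.
move=> n2; apply: sin_gt0_pi; rewrite step_gt0 ?(ltn_trans _ n2)//=.
rewrite ltr_pdivrMr ?ltr0n ?(ltn_trans _ n2)// mulrC ltr_pM2l ?pi_gt0//.
by rewrite ltr_nat.
Qed.

(** With [u = (k+1) pi / n] and [v = (k-1) pi / n], the difference [cos (u - v) - cos (u + v)]
    equals [2 sin u sin v], and both sines are positive. *)
Lemma cos_step_max n k : (1 < k)%N -> (k.+1 < n)%N -> cos (k%:R * step n) < cos (step n).
Proof.
move=> k1 kn; have n0 : 0 < n%:R :> R by rewrite ltr0n; lia.
have sp j : (0 < j < n)%N -> 0 < sin (j%:R * (pi / n%:R)) :> R.
  move=> /andP[j0 jn]; apply: sin_gt0_pi; rewrite mulr_gt0 ?(ltr0n _ j) ?divr_gt0 ?pi_gt0//=.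
  by rewrite mulrCA gtr_pMr ?pi_gt0// ltr_pdivrMr// mul1r ltr_nat.
have -> : k%:R * step n = k.+1%:R * (pi / n%:R) + k.-1%:R * (pi / n%:R).
  by rewrite /step -mulrDl -natrD (_ : (_ + _)%N = (k * 2)%N) ?natrM; [field; rewrite gt_eqF|lia].
have -> : step n = k.+1%:R * (pi / n%:R) - k.-1%:R * (pi / n%:R).
  rewrite /step -mulrBl -natrB; last by lia.
  by rewrite (_ : (_ - _)%N = 2%N); [field; rewrite gt_eqF|lia].
have s1 : 0 < sin (k.+1%:R * (pi / n%:R)) :> R by apply: sp; lia.
have s2 : 0 < sin (k.-1%:R * (pi / n%:R)) :> R by apply: sp; lia.
rewrite cosD cosB; nra.
Qed.

(* Mode [k] of the area form has the sign of [cos (k d) - cos d]: positive only for [k = 0]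
   and zero only for [k = 1, n - 1], the modes killed by the three constraints. *)
Lemma area_negative_definite n f : (2 < n)%N ->
  \sum_(j < n) f j = 0 -> cosT n f 1 = 0 -> sinT n f 1 = 0 ->
  \sum_(j < n) f j * support_number (step n) f j <=
  - (sin (step n) / 4) * \sum_(j < n) f j ^+ 2.
Proof.
case: n => // N n2 f0 fc fs; set h := support_number _ _.
have n0 : 0 < N.+1%:R :> R by rewrite ltr0n.
rewrite -(ler_pM2l n0) -parseval mulrCA.
rewrite [X in - _ * (_ * X)](eq_bigr (fun j : 'I_N.+1 => f j * f j)) => [|j _]; last by rewrite expr2.
rewrite -parseval mulr_sumr; apply: ler_sum => k _.
have sd := @sin_step_gt0 N.+1 n2.
have [z|[zk1 zk2]] : (cosT N.+1 f k = 0 /\ sinT N.+1 f k = 0) \/ (1 < k)%N /\ (k.+1 < N.+1)%N.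
  have [k0|k0] := eqVneq (k : nat) 0%N.
    left; rewrite k0 /cosT /sinT; split.
      by rewrite -[RHS]f0; apply: eq_bigr => j _; rewrite mul0r cos0 mulr1.
    by apply: big1 => j _; rewrite mul0r sin0 mulr0.
  have [->|k1] := eqVneq (k : nat) 1%N; first by left.
  have [->|kN] := eqVneq (k : nat) N.
    by left; rewrite cosT_symm sinT_symm fc fs oppr0.
  by right; case: k k0 k1 kN => /= *; split; lia.
  by case: z => -> ->; rewrite !mul0r !addr0 mulr0.
have := cos_step_max _ _ zk1 zk2.
have := @cosT_support_number N f fc fs k; have := @sinT_support_number N f fc fs k.
rewrite -/h; have := cos_geN1 (k%:R * step N.+1); have := cos_le1 (step N.+1).
move: (cosT _ f _) (sinT _ f _) (cosT _ h _) (sinT _ h _)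
  (cos (step N.+1)) (cos (k%:R * step N.+1)) (sin _) sd.
move=> a b a' b' u v s s0 u1 v1 Hb Ha uv.
have m0 : 0 < 2 * (u - v) by lra.
(* The multiplier gives [w w' = - s w^2 / (2 (u - v))]; the bound [u - v <= 2] between two cosines
   is the source of the constant [1/4]. *)
have key w w' : s * w = 2 * (v - u) * w' -> w * w' <= - (s / 4) * (w * w).
  move=> H; rewrite -(ler_pM2l m0).
  have -> : 2 * (u - v) * (w * w') = - (s * w ^+ 2) by rewrite expr2 [s * _]mulrA H; ring.
  have q0 : 0 <= s * w ^+ 2 by rewrite mulr_ge0 ?sqr_ge0 ?ltW.
  have : 0 <= s * w ^+ 2 * (4 - 2 * (u - v)) by rewrite mulr_ge0 //; lra.
  move: q0; rewrite expr2; lra.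
by rewrite mulrDr lerD ?key.
Qed.

End DiscreteFourier.

Arguments step {R} n.
Arguments cosT {R} n f k.
Arguments sinT {R} n f k.
Arguments support_number {R} d f j.

(** * Entries of revolute twists and of their pairwise products *)

Section TwistEntries.
Variable R : realType.
Implicit Types (w q v : 'cV[R]_3).

Lemma ord3E : (lift ord0 ord0 = 1 :> 'I_3) * (lift ord0 (lift ord0 ord0) = 2 :> 'I_3).
Proof. by split; apply/val_inj. Qed.

Lemma ord4E : (lift ord0 ord0 = 1 :> 'I_4) * (lift ord0 (lift ord0 ord0) = 2 :> 'I_4) *
  (lift ord0 (lift ord0 (lift ord0 ord0)) = 3 :> 'I_4).
Proof. by split; [split|]; apply/val_inj. Qed.

Lemma ord4P (i : 'I_4) : [\/ i = 0, i = 1, i = 2 | i = 3].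
Proof.
case: i => [[|[|[|[|//]]]] Hi]; [constructor 1|constructor 2|constructor 3|constructor 4];
  exact/val_inj.
Qed.

Lemma mulmx4E (A B : 'M[R]_4) i j :
  (A * B) i j = A i 0 * B 0 j + (A i 1 * B 1 j + (A i 2 * B 2 j + A i 3 * B 3 j)).
Proof. by rewrite -mulmxE mxE !big_ord_recl big_ord0 !ord4E addr0. Qed.

Lemma mulmx3E (A : 'M[R]_3) w i :
  (A *m w) i 0 = A i 0 * w 0 0 + (A i 1 * w 1 0 + A i 2 * w 2 0).
Proof. by rewrite mxE !big_ord_recl big_ord0 !ord3E addr0. Qed.

Lemma twist_hatE w v : twist_hat w v = \matrix_(i < 4, j < 4)
  nth 0 (nth [::] [:: [:: 0; - w 2 0; w 1 0; v 0 0];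
                      [:: w 2 0; 0; - w 0 0; v 1 0];
                      [:: - w 1 0; w 0 0; 0; v 2 0];
                      [:: 0; 0; 0; 0]] i) j.
Proof.
apply/matrixP => i j; rewrite !mxE.
have E0 : inord 0 = 0 :> 'I_3 by apply/val_inj; rewrite /= inordK.
have E1 : inord 1 = 1 :> 'I_3 by apply/val_inj; rewrite /= inordK.
have E2 : inord 2 = 2 :> 'I_3 by apply/val_inj; rewrite /= inordK.
by have [->|->|->|->] := ord4P i; have [->|->|->|->] := ord4P j => //=;
  rewrite ?E0 ?E1 ?E2 ?mxE.
Qed.

Lemma twist_hat_entries w v :
  ((twist_hat w v 0 0 = 0) * (twist_hat w v 0 1 = - w 2 0) *
   (twist_hat w v 0 2 = w 1 0) * (twist_hat w v 0 3 = v 0 0)) *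
  ((twist_hat w v 1 0 = w 2 0) * (twist_hat w v 1 1 = 0) *
   (twist_hat w v 1 2 = - w 0 0) * (twist_hat w v 1 3 = v 1 0)) *
  ((twist_hat w v 2 0 = - w 1 0) * (twist_hat w v 2 1 = w 0 0) *
   (twist_hat w v 2 2 = 0) * (twist_hat w v 2 3 = v 2 0)) *
  ((twist_hat w v 3 0 = 0) * (twist_hat w v 3 1 = 0) *
   (twist_hat w v 3 2 = 0) * (twist_hat w v 3 3 = 0)).
Proof. by rewrite twist_hatE; do !split; rewrite mxE. Qed.

Lemma crossE u v : (cross u v 0 0 = u 1 0 * v 2 0 - u 2 0 * v 1 0 :> R) *
  (cross u v 1 0 = u 2 0 * v 0 0 - u 0 0 * v 2 0 :> R) *
  (cross u v 2 0 = u 0 0 * v 1 0 - u 1 0 * v 0 0 :> R).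
Proof. by do !split; rewrite !mxE. Qed.

Lemma sqnormE w : (w^T *m w) 0 0 = w 0 0 ^+ 2 + w 1 0 ^+ 2 + w 2 0 ^+ 2.
Proof. by rewrite mxE !big_ord_recl big_ord0 !ord3E addr0 !mxE addrA -!expr2. Qed.

(** The translation part [q x w] is orthogonal to [w] (zero pitch), so the cubic identity of the
    skew matrix of a unit vector extends to the whole twist. *)
Lemma revolute_twist_cube w q : (w^T *m w) 0 0 = 1 ->
  revolute_twist w q ^+ 3 = - revolute_twist w q.
Proof.
rewrite sqnormE => w1.
suff -> : revolute_twist w q ^+ 3 =
    - (w 0 0 ^+ 2 + w 1 0 ^+ 2 + w 2 0 ^+ 2) *: revolute_twist w q.
  by rewrite w1 scaleN1r.
rewrite exprS expr2 /revolute_twist; apply/matrixP => i j; rewrite [RHS]mxE.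
by have [->|->|->|->] := ord4P i; have [->|->|->|->] := ord4P j;
  rewrite !mulmx4E !twist_hat_entries !crossE; ring.
Qed.

Lemma Rz_mulE a w : ((Rz a *m w) 0 0 = cos a * w 0 0 - sin a * w 1 0) *
  ((Rz a *m w) 1 0 = sin a * w 0 0 + cos a * w 1 0) * ((Rz a *m w) 2 0 = w 2 0).
Proof. by do !split; rewrite mulmx3E !mxE /=; ring. Qed.

Lemma sqnorm_Rz a w : ((Rz a *m w)^T *m (Rz a *m w)) 0 0 = (w^T *m w) 0 0.
Proof.
rewrite !sqnormE !Rz_mulE -[in RHS](mul1r (w 0 0 ^+ 2)) -[in RHS](mul1r (w 1 0 ^+ 2)).
rewrite -(cos2Dsin2 a); ring.
Qed.

Section RotatedTwist.
Variables w q : 'cV[R]_3.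
Hypothesis q_z : q 2 0 = 0.

Definition rotated_twist a := revolute_twist (Rz a *m w) (Rz a *m q).

(* Vanishes iff the axis is coplanar with the [z]-axis. *)
Definition moment_z : R := q 0 0 * w 1 0 - q 1 0 * w 0 0.
Definition planar_sqnorm : R := w 0 0 ^+ 2 + w 1 0 ^+ 2.
Definition planar_dot : R := q 0 0 * w 0 0 + q 1 0 * w 1 0.

(** The horizontal components depend on the angle through its first harmonic and will yield the
    closing vector of the polygon; the [z]-components are independent of the angle and will yield
    the plain sum of the sines. *)
Lemma rotated_twist_entries a :
  (rotated_twist a 0 2 = sin a * w 0 0 + cos a * w 1 0) *
  (rotated_twist a 1 2 = - (cos a * w 0 0 - sin a * w 1 0)) *
  (rotated_twist a 1 0 - rotated_twist a 0 1 = 2 * w 2 0) *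
  (rotated_twist a 2 3 = moment_z).
Proof.
rewrite /rotated_twist /revolute_twist !twist_hat_entries !crossE !Rz_mulE.
do !split => //; first by ring.
transitivity ((cos a ^+ 2 + sin a ^+ 2) * moment_z); first by rewrite /moment_z; ring.
by rewrite cos2Dsin2 mul1r.
Qed.

(** The antisymmetric part of a product of two skew matrices is the cross product of their axes; its
    [z]-component is the source of the polygon area. *)
Lemma rotated_twist_mul_rot a b :
  (rotated_twist a * rotated_twist b) 1 0 - (rotated_twist a * rotated_twist b) 0 1 =
  planar_sqnorm * sin (b - a).
Proof.
rewrite /rotated_twist /revolute_twist !mulmx4E !twist_hat_entries !crossE !Rz_mulE.
rewrite sinB /planar_sqnorm; ring.
Qed.

Lemma rotated_twist_mul_trans a b :
  (rotated_twist a * rotated_twist b) 2 3 =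
  - (w 2 0) * planar_dot * cos (b - a) - w 2 0 * moment_z * sin (b - a).
Proof.
rewrite /rotated_twist /revolute_twist !mulmx4E !twist_hat_entries !crossE !Rz_mulE q_z.
rewrite sinB cosB /planar_dot /moment_z; ring.
Qed.

End RotatedTwist.
End TwistEntries.

Arguments rotated_twist {R} w q a.
Arguments moment_z {R} w q.
Arguments planar_sqnorm {R} w.
Arguments planar_dot {R} w q.

(** * Rodrigues formula for the exponential *)

Section Rodrigues.
Variable R : realType.
Implicit Types (A : 'M[R]_4) (t : R).

(** The powers cycle through [A], [A^2], [-A], [-A^2]; the parity selectors are those of [sin_coeff]
    and [cos_coeff]. *)
Lemma expr_skew_like A k : A ^+ 3 = - A ->
  A ^+ k.+1 = ((odd k.+1)%:R * (-1) ^+ k./2) *: A -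
              ((~~ odd k.+1)%:R * (-1) ^+ k.+1./2) *: A ^+ 2.
Proof.
move=> A3; elim: k => [|k IHk]; first by rewrite !mul1r mul0r scale1r scale0r subr0 expr1.
rewrite exprSr IHk mulrBl -!scalerAl -exprSr A3 scalerN opprK addrC.
rewrite [odd k.+2]/= [k.+2./2]/= exprS !mulN1r !mulrN scaleNr opprK negbK.
by rewrite -expr2.
Qed.

Lemma expm_rodrigues A t : A ^+ 3 = - A ->
  expm (t *: A) = 1 + sin t *: A + (1 - cos t) *: A ^+ 2.
Proof.
move=> A3; apply: cvg_lim; first exact: norm_hausdorff.
(* The next identity fails for the empty partial sum: the index-zero terms supply the identity
   matrix and cancel the [1] in [1 - cos]. *)
rewrite -cvg_shiftS.
have -> : (fun N => \sum_(k < N.+1) (k`!%:R)^-1 *: (t *: A) ^+ k) =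
    (fun N => 1 + series (sin_coeff t) N.+1 *: A +
      (1 - series (cos_coeff t) N.+1) *: A ^+ 2).
  apply/funext => N; rewrite !seriesEord /=.
  elim: N => [|N IHN].
    rewrite !big_ord1 sin_coeffE cos_coeffE /= !expr0 fact0 invr1 !mulr1.
    by rewrite subrr scale1r !scale0r !addr0.
  rewrite big_ord_recr /= IHN [X in _ = 1 + X *: _ + _]big_ord_recr
    [X in _ = _ + (1 - X) *: _]big_ord_recr /=.
  have -> : (N.+1`!%:R)^-1 *: (t *: A) ^+ N.+1 =
      sin_coeff t N.+1 *: A - cos_coeff t N.+1 *: A ^+ 2.
    rewrite exprZn (expr_skew_like A N)// sin_coeffE cos_coeffE.
    rewrite !scalerBr !scalerA [N.+1.-1]/=.
    by congr (_ *: _ - _ *: _); rewrite mulrC !mulrA.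
  move: (A ^+ 2) (sin_coeff _ _) (cos_coeff _ _) (\sum_(_ < _) _) (\sum_(_ < _) _).
  by move=> B u v U V; apply/matrixP => i j; rewrite !mxE; ring.
have scvg : (series (sin_coeff t) N.+1 @[N --> \oo] --> sin t)%classic.
  by rewrite cvg_shiftS sin.unlock; exact: is_cvg_series_sin_coeff.
have ccvg : (series (cos_coeff t) N.+1 @[N --> \oo] --> cos t)%classic.
  by rewrite cvg_shiftS cos.unlock; exact: is_cvg_series_cos_coeff.
apply: cvgD; last first.
  by apply: cvgZr_tmp; apply: cvgB => //; exact: cvg_cst.
by apply: cvgD; [exact: cvg_cst|exact: cvgZr_tmp].
Qed.

End Rodrigues.

(** * Uniform order estimates for functions and matrices *)

Section BigO.
Variables (R : realType) (T : Type) (e : T -> R).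
Hypothesis e_ge0 : forall x, 0 <= e x.
Hypothesis e_le1 : forall x, e x <= 1.
Implicit Types (f g : T -> R) (k l : nat).

(* Uniform bound over all of [T], rather than a limit along a filter. *)
Definition bigO k f := exists2 C, 0 <= C & forall x, `|f x| <= C * e x ^+ k.

Lemma bigO_ext k f g : f =1 g -> bigO k f -> bigO k g.
Proof. by move=> fg [C C0 H]; exists C => // x; rewrite -fg. Qed.

Lemma bigO_cst c : bigO 0 (fun=> c).
Proof. by exists `|c| => // x; rewrite expr0 mulr1. Qed.

Lemma bigOD k f g : bigO k f -> bigO k g -> bigO k (fun x => f x + g x).
Proof.
move=> [C C0 Hf] [D D0 Hg]; exists (C + D); first exact: addr_ge0.
by move=> x; rewrite mulrDl (le_trans (ler_normD _ _))// lerD.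
Qed.

Lemma bigON k f : bigO k f -> bigO k (fun x => - f x).
Proof. by move=> [C C0 H]; exists C => // x; rewrite normrN. Qed.

Lemma bigOB k f g : bigO k f -> bigO k g -> bigO k (fun x => f x - g x).
Proof. by move=> Hf Hg; apply: bigOD => //; exact: bigON. Qed.

Lemma bigOM k l f g : bigO k f -> bigO l g -> bigO (k + l) (fun x => f x * g x).
Proof.
move=> [C C0 Hf] [D D0 Hg]; exists (C * D); first exact: mulr_ge0.
by move=> x; rewrite normrM exprD mulrACA ler_pM.
Qed.

Lemma bigOZ k c f : bigO k f -> bigO k (fun x => c * f x).
Proof. by move=> Hf; exact: (bigOM 0 k _ _ (bigO_cst c) Hf). Qed.

Lemma bigO_le k l f : (k <= l)%N -> bigO l f -> bigO k f.
Proof.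
move=> kl [C C0 H]; exists C => // x; apply: le_trans (H x) _.
by rewrite ler_wpM2l// ler_wiXn2l// e_ge0.
Qed.

Lemma bigO_sum k n (F : nat -> T -> R) : (forall i, (i < n)%N -> bigO k (F i)) ->
  bigO k (fun x => \sum_(i < n) F i x).
Proof.
elim: n => [|n IHn] HF.
  by exists 0 => // x; rewrite big_ord0 normr0 mul0r.
apply: (@bigO_ext _ (fun x => \sum_(i < n) F i x + F n x)).
  by move=> x; rewrite big_ord_recr.
by apply: bigOD; [apply: IHn => i ni; apply: HF; lia|exact: HF].
Qed.

Definition mx_bigO p k (F : T -> 'M[R]_p) := forall i j, bigO k (fun x => F x i j).
Arguments mx_bigO {p} k F.

Lemma mx_bigO_ext p k (F G : T -> 'M[R]_p) : F =1 G -> mx_bigO k F -> mx_bigO k G.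
Proof. by move=> FG HF i j; apply: bigO_ext (HF i j) => x; rewrite FG. Qed.

Lemma mx_bigO_cst p (A : 'M[R]_p) : mx_bigO 0 (fun=> A).
Proof. by move=> i j; exact: bigO_cst. Qed.

Lemma mx_bigOD p k (F G : T -> 'M[R]_p) :
  mx_bigO k F -> mx_bigO k G -> mx_bigO k (fun x => F x + G x).
Proof.
move=> HF HG i j; apply: bigO_ext (bigOD _ _ _ (HF i j) (HG i j)) => x.
by rewrite mxE.
Qed.

Lemma mx_bigO_le p k l (F : T -> 'M[R]_p) : (k <= l)%N -> mx_bigO l F -> mx_bigO k F.
Proof. by move=> kl HF i j; exact: bigO_le (HF i j). Qed.

Lemma mx_bigOZ p k l f (F : T -> 'M[R]_p) :
  bigO k f -> mx_bigO l F -> mx_bigO (k + l) (fun x => f x *: F x).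
Proof.
move=> Hf HF i j; apply: bigO_ext (bigOM _ _ _ _ Hf (HF i j)) => x.
by rewrite mxE.
Qed.

Lemma mx_bigOM p k l (F G : T -> 'M[R]_p) :
  mx_bigO k F -> mx_bigO l G -> mx_bigO (k + l) (fun x => F x *m G x).
Proof.
(* [bigO_sum] takes families indexed by [nat], hence the detour through [inord], which needs a
   nonempty index type. *)
case: p F G => [|p] F G HF HG i j; first by case: i.
apply: (@bigO_ext _ (fun x => \sum_(m < p.+1) F x i (inord m) * G x (inord m) j)).
  by move=> x; rewrite mxE; apply: eq_bigr => m _; rewrite inord_val.
by apply: (bigO_sum _ _ (fun m x => F x i (inord m) * G x (inord m) j)) => m _; exact: bigOM.
Qed.

Lemma mx_bigO_sum p k n (F : nat -> T -> 'M[R]_p) :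
  (forall i, (i < n)%N -> mx_bigO k (F i)) -> mx_bigO k (fun x => \sum_(i < n) F i x).
Proof.
move=> HF i j; apply: (@bigO_ext _ (fun x => \sum_(m < n) F m x i j)).
  by move=> x; rewrite summxE.
by apply: (bigO_sum _ _ (fun m x => F m x i j)) => m mn; exact: HF.
Qed.

(** * Second-order expansion of a product of rotations *)

Section ProductExpansion.
Variables (p : nat) (s c : nat -> T -> R) (A : nat -> 'M[R]_p.+1).
Hypothesis s_bigO : forall i, bigO 1 (s i).
Hypothesis c_bigO : forall i, bigO 3 (fun x => c i x - s i x ^+ 2 / 2).

Definition first_order n x := \sum_(i < n) s i x *: A i.
(** Here [s^2 / 2] stands in for [c], modelled on [1 - cos t] against [sin t ^ 2 / 2]. Mixed terms
    keep the order of the product, as the matrices need not commute. *)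
Definition second_order n x := \sum_(j < n)
  ((s j x ^+ 2 / 2) *: A j ^+ 2 + \sum_(i < j) (s i x * s j x) *: (A i * A j)).

Lemma first_order_bigO n : mx_bigO 1 (first_order n).
Proof.
apply: (mx_bigO_sum _ _ _ (fun i x => s i x *: A i)) => i _.
exact: mx_bigOZ (s_bigO i) (mx_bigO_cst _ _).
Qed.

Lemma sqr_half_bigO i : bigO 2 (fun x => s i x ^+ 2 / 2).
Proof.
apply: bigO_ext (bigOZ _ 2^-1 _ (bigOM _ _ _ _ (s_bigO i) (s_bigO i))) => x.
by rewrite mulrC expr2.
Qed.

Lemma second_order_bigO n : mx_bigO 2 (second_order n).
Proof.
apply: (mx_bigO_sum _ _ _ (fun j x => (s j x ^+ 2 / 2) *: A j ^+ 2 +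
  \sum_(i < j) (s i x * s j x) *: (A i * A j))) => j _.
apply: mx_bigOD; first exact: mx_bigOZ (sqr_half_bigO j) (mx_bigO_cst _ _).
apply: (mx_bigO_sum _ _ _ (fun i x => (s i x * s j x) *: (A i * A j))) => i _.
exact: mx_bigOZ (bigOM _ _ _ _ (s_bigO i) (s_bigO j)) (mx_bigO_cst _ _).
Qed.

Lemma c_bigO2 i : bigO 2 (c i).
Proof.
have := bigOD _ _ _ (bigO_le 2 3 _ isT (c_bigO i)) (sqr_half_bigO i).
by apply: bigO_ext => x; rewrite subrK.
Qed.

Lemma prod_expansion n : mx_bigO 3 (fun x =>
  \prod_(i < n) (1 + s i x *: A i + c i x *: A i ^+ 2) - 1 -
    first_order n x - second_order n x).
Proof.
elim: n => [|n IHn].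
  move=> i j; exists 0 => // x.
  by rewrite /first_order /second_order !big_ord0 subrr !subr0 mxE normr0 mul0r.
set P := fun x => \prod_(i < n) (1 + s i x *: A i + c i x *: A i ^+ 2) in IHn *.
(* Regroups the remainder after one more factor on the right into four terms, each visibly of order
   three. *)
apply: (@mx_bigO_ext _ _ (fun x =>
  (P x - 1 - first_order n x - second_order n x) *m (1 + s n x *: A n + c n x *: A n ^+ 2) +
  second_order n x *m (s n x *: A n + c n x *: A n ^+ 2) +
  first_order n x *m (c n x *: A n ^+ 2) + (c n x - s n x ^+ 2 / 2) *: A n ^+ 2)).
  move=> x; rewrite big_ord_recr /= -/(P x).
  rewrite {3}/first_order {3}/second_order !big_ord_recr /=.
  rewrite -/(first_order n x) -/(second_order n x).
  have -> : \sum_(i < n) (s i x * s n x) *: (A i * A n) = first_order n x * (s n x *: A n).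
    rewrite mulr_suml; apply: eq_bigr => i _.
    by rewrite -scalerAl -scalerAr scalerA.
  rewrite !mulmxE scalerBl !mulrDr !mulr1 !mulrBl !mul1r.
  apply/matrixP => i j; rewrite !mxE; ring.
have sA : mx_bigO 1 (fun x => s n x *: A n).
  exact: mx_bigOZ (s_bigO n) (mx_bigO_cst _ _).
have cA : mx_bigO 2 (fun x => c n x *: A n ^+ 2).
  exact: mx_bigOZ (c_bigO2 n) (mx_bigO_cst _ _).
apply: mx_bigOD; last exact: mx_bigOZ (c_bigO n) (mx_bigO_cst _ _).
apply: mx_bigOD; last exact: mx_bigOM (first_order_bigO n) cA.
apply: mx_bigOD.
  apply: (mx_bigOM _ 3 0) => //; apply: mx_bigOD; last exact: mx_bigO_le cA.
  by apply: mx_bigOD; [exact: mx_bigO_cst|exact: mx_bigO_le sA].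
apply: (mx_bigOM _ 2 1); first exact: second_order_bigO.
by apply: mx_bigOD => //; exact: mx_bigO_le cA.
Qed.

Variable n_closed : nat.
Hypothesis closure : forall x,
  \prod_(i < n_closed) (1 + s i x *: A i + c i x *: A i ^+ 2) = 1.

Lemma closure_second_order :
  mx_bigO 3 (fun x => first_order n_closed x + second_order n_closed x).
Proof.
move=> i j; apply: bigO_ext (bigON _ _ (prod_expansion n_closed i j)) => x.
rewrite closure !mxE; ring.
Qed.

Lemma closure_first_order : mx_bigO 2 (first_order n_closed).
Proof.
move=> i j.
have := bigOB _ _ _ (bigO_le 2 3 _ isT (closure_second_order i j)) (second_order_bigO n_closed i j).
by apply: bigO_ext => x; rewrite [X in X - _]mxE addrK.
Qed.

End ProductExpansion.

(** * Closure forces the squared norm of the sines to be of third order *)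

Section SecondOrderRigidity.
Variables (n : nat) (w q : 'cV[R]_3) (s c : nat -> T -> R).
Let A j := rotated_twist w q (j%:R * step n).
Hypothesis n_gt2 : (2 < n)%N.
Hypothesis q_z : q 2 0 = 0.
Hypothesis moment_neq0 : moment_z w q != 0.
Hypothesis planar_neq0 : planar_sqnorm w != 0.
Hypothesis s_bigO : forall i, bigO 1 (s i).
Hypothesis c_bigO : forall i, bigO 3 (fun x => c i x - s i x ^+ 2 / 2).
Hypothesis closure : forall x,
  \prod_(i < n) (1 + s i x *: A i + c i x *: A i ^+ 2) = 1.

Let X := first_order _ s A n.
Let Y := second_order _ s A n.
Let sigma x := \sum_(j < n) s j x.
Let cs x := cosT n (s^~ x) 1.
Let sn x := sinT n (s^~ x) 1.
Let area x := \sum_(j < n) s j x * support_number (step n) (s^~ x) j.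

Lemma first_orderE x i j : X x i j = \sum_(k < n) s k x * A k i j.
Proof. by rewrite /X /first_order summxE; apply: eq_bigr => k _; rewrite mxE. Qed.

Lemma second_orderE x i j : Y x i j = \sum_(k < n)
  (s k x ^+ 2 / 2 * (A k * A k) i j + \sum_(m < k) s m x * s k x * (A m * A k) i j).
Proof.
rewrite /Y /second_order summxE; apply: eq_bigr => k _.
rewrite !mxE summxE expr2; congr (_ + _).
by apply: eq_bigr => m _; rewrite mxE.
Qed.

Lemma first_order_rot x : X x 1 0 - X x 0 1 = 2 * w 2 0 * sigma x.
Proof.
rewrite !first_orderE -sumrB mulr_sumr; apply: eq_bigr => k _.
by rewrite -mulrBr rotated_twist_entries mulrC.
Qed.

Lemma second_order_rot x : Y x 1 0 - Y x 0 1 = planar_sqnorm w * area x.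
Proof.
rewrite !second_orderE -sumrB mulr_sumr; apply: eq_bigr => k _.
rewrite opprD addrACA -mulrBr rotated_twist_mul_rot subrr sin0 !mulr0 add0r.
rewrite -sumrB /support_number !mulr_sumr; apply: eq_bigr => m _.
by rewrite -mulrBr rotated_twist_mul_rot -mulrBl; ring.
Qed.

Lemma first_order_trans x : X x 2 3 = moment_z w q * sigma x.
Proof.
rewrite !first_orderE mulr_sumr; apply: eq_bigr => k _.
by rewrite rotated_twist_entries mulrC.
Qed.

(** Half of the expanded squared length of the closing vector. It makes the cosine part of the
    translation equation quadratic in [cs] and [sn], hence negligible. *)
Lemma half_sqnorm_sum (d : R) (f : nat -> R) N :
  \sum_(k < N) (f k ^+ 2 / 2 + \sum_(m < k) f m * f k * cos (k%:R * d - m%:R * d)) =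
  ((\sum_(k < N) f k * cos (k%:R * d)) ^+ 2 + (\sum_(k < N) f k * sin (k%:R * d)) ^+ 2) / 2.
Proof.
elim: N => [|N IHN]; first by rewrite !big_ord0; ring.
rewrite !big_ord_recr /= IHN.
have -> : \sum_(m < N) f m * f N * cos (N%:R * d - m%:R * d) =
    f N * (cos (N%:R * d) * (\sum_(k < N) f k * cos (k%:R * d)) +
           sin (N%:R * d) * (\sum_(k < N) f k * sin (k%:R * d))).
  rewrite !mulr_sumr -big_split mulr_sumr; apply: eq_bigr => m _.
  by rewrite cosB /=; ring.
have -> : f N ^+ 2 / 2 = f N ^+ 2 * (cos (N%:R * d) ^+ 2 + sin (N%:R * d) ^+ 2) / 2.
  by rewrite cos2Dsin2 mulr1.
by field.
Qed.

Lemma second_order_trans x : Y x 2 3 =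
  - (w 2 0) * planar_dot w q * ((cs x ^+ 2 + sn x ^+ 2) / 2) -
  w 2 0 * moment_z w q * area x.
Proof.
have -> : (cs x ^+ 2 + sn x ^+ 2) / 2 = \sum_(k < n) (s k x ^+ 2 / 2 +
    \sum_(m < k) s m x * s k x * cos (k%:R * step n - m%:R * step n)).
  rewrite (half_sqnorm_sum (step n) (s^~ x)) /cs /sn /cosT /sinT.
  by congr ((_ ^+ 2 + _ ^+ 2) / 2); apply: eq_bigr => k _; rewrite mul1r.
rewrite second_orderE !mulr_sumr -sumrB; apply: eq_bigr => k _.
rewrite rotated_twist_mul_trans// subrr cos0 sin0 /support_number.
rewrite [in RHS]mulrDr !mulr_sumr -[in RHS]addrA -[in RHS]sumrB; congr (_ + _); first by ring.
apply: eq_bigr => m _; rewrite rotated_twist_mul_trans//.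
by rewrite [(_ - _) * step n]mulrBl; ring.
Qed.

Let X_bigO : mx_bigO 2 X := closure_first_order _ _ _ _ s_bigO c_bigO _ closure.
Let XY_bigO : mx_bigO 3 (fun x => X x + Y x) :=
  closure_second_order _ _ _ _ s_bigO c_bigO _ closure.

Lemma bigO_scale_cancel k a f : a != 0 -> bigO k (fun x => a * f x) -> bigO k f.
Proof.
by move=> a0 H; apply: bigO_ext (bigOZ _ a^-1 _ H) => x; rewrite mulrA mulVf ?mul1r.
Qed.

(** Entries [(0,2)] and [(1,2)] of the first-order term form a linear system in [cs] and [sn],
    solved by Cramer's rule with determinant [planar_sqnorm w] up to sign. *)
Lemma cs_sn_bigO : bigO 2 cs /\ bigO 2 sn.
Proof.
have E02 x : X x 0 2 = w 0 0 * sn x + w 1 0 * cs x.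
  rewrite first_orderE /cs /sn /cosT /sinT !mulr_sumr -big_split /=.
  by apply: eq_bigr => k _; rewrite rotated_twist_entries mul1r; ring.
have E12 x : X x 1 2 = w 1 0 * sn x - w 0 0 * cs x.
  rewrite first_orderE /cs /sn /cosT /sinT !mulr_sumr -sumrB /=.
  by apply: eq_bigr => k _; rewrite rotated_twist_entries mul1r; ring.
split; apply: (bigO_scale_cancel _ _ _ planar_neq0).
- apply: bigO_ext (bigOB _ _ _ (bigOZ _ (w 1 0) _ (X_bigO 0 2))
    (bigOZ _ (w 0 0) _ (X_bigO 1 2))) => x.
  by rewrite E02 E12 /planar_sqnorm; ring.
- apply: bigO_ext (bigOD _ _ _ (bigOZ _ (w 0 0) _ (X_bigO 0 2))
    (bigOZ _ (w 1 0) _ (X_bigO 1 2))) => x.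
  by rewrite E02 E12 /planar_sqnorm; ring.
Qed.

(* The [z]-components of the closure equation read
   [2 w_z sigma + |w_xy|^2 area = O(3)] and [m (sigma - w_z area) = O(3)],
   a system of determinant [- m (|w_xy|^2 + 2 w_z^2)]. *)
Lemma area_sigma_bigO : bigO 3 area /\ bigO 3 sigma.
Proof.
have [csO snO] := cs_sn_bigO.
have E1 : bigO 3 (fun x => 2 * w 2 0 * sigma x + planar_sqnorm w * area x).
  apply: bigO_ext (bigOB _ _ _ (XY_bigO 1 0) (XY_bigO 0 1)) => x.
  rewrite -first_order_rot -second_order_rot mxE [(X x + Y x) 0 1]mxE; ring.
have E2 : bigO 3 (fun x => sigma x - w 2 0 * area x).
  apply: (bigO_scale_cancel _ _ _ moment_neq0).
  have Z : bigO 3 (fun x => w 2 0 * planar_dot w q / 2 * (cs x * cs x + sn x * sn x)).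
    apply: bigOZ; apply: (@bigO_le _ 4) => //.
    by apply: bigOD; exact: (bigOM 2 2).
  apply: bigO_ext (bigOD _ _ _ (XY_bigO 2 3) Z) => x.
  rewrite mxE first_order_trans second_order_trans; by field.
have areaO : bigO 3 area.
  have nz : planar_sqnorm w + 2 * w 2 0 ^+ 2 != 0.
    rewrite gt_eqF// ltr_wpDr//; first by rewrite mulr_ge0 ?sqr_ge0.
    by rewrite lt0r planar_neq0 /= addr_ge0 ?sqr_ge0.
  apply: (bigO_scale_cancel _ _ _ nz).
  apply: bigO_ext (bigOB _ _ _ E1 (bigOZ _ (2 * w 2 0) _ E2)) => x.
  ring.
split => //; apply: bigO_ext (bigOD _ _ _ E2 (bigOZ _ (w 2 0) _ areaO)) => x.
ring.
Qed.

(** Orthogonal projection of the sines onto the closed polygons of zero signed perimeter; [n] and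
    [n / 2] are the squared norms of the constant vector and of the first harmonics. *)
Let s' x j := s j x - sigma x / n%:R -
  2 / n%:R * (cs x * cos (j%:R * step n) + sn x * sin (j%:R * step n)).

Lemma projection_constraints x :
  [/\ \sum_(j < n) s' x j = 0, cosT n (s' x) 1 = 0 & sinT n (s' x) 1 = 0].
Proof.
have n0 : n%:R != 0 :> R by rewrite pnatr_eq0; lia.
have C1 : \sum_(j < n) cos (j%:R * step n) = 0 :> R.
  rewrite -[RHS](@sum_cos_root_of_unity0 R n 1); last by lia.
  by apply: eq_bigr => j _; rewrite mul1r.
have S1 : \sum_(j < n) sin (j%:R * step n) = 0 :> R.
  rewrite -[RHS](@sum_sin_root_of_unity0 R n 1); last by lia.
  by apply: eq_bigr => j _; rewrite mul1r.
(* The second harmonics sum to zero because [2 < n]. *)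
have C2 : \sum_(j < n) (cos (j%:R * step n) ^+ 2 - sin (j%:R * step n) ^+ 2) = 0 :> R.
  rewrite -[RHS](@sum_cos_root_of_unity0 R n 2); last by lia.
  apply: eq_bigr => j _.
  have -> : j%:R * (2 * step n) = j%:R * step n + j%:R * step n :> R by ring.
  by rewrite cosD; ring.
have SC : \sum_(j < n) (sin (j%:R * step n) * cos (j%:R * step n)) = 0 :> R.
  have := @sum_sin_root_of_unity0 R n 2; rewrite n_gt2 => /(_ isT) H.
  apply/eqP; rewrite -(mulrI_eq0 _ (lregP _ : GRing.lreg (2 : R))) ?pnatr_eq0 ?mulr_sumr//.
  rewrite -[X in _ == X]H; apply/eqP/eq_bigr => j _.
  have -> : j%:R * (2 * step n) = j%:R * step n + j%:R * step n :> R by ring.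
  by rewrite sinD; ring.
have CS : \sum_(j < n) (cos (j%:R * step n) * sin (j%:R * step n)) = 0 :> R.
  by rewrite -[RHS]SC; apply: eq_bigr => j _; rewrite mulrC.
have CS1 : \sum_(j < n) (cos (j%:R * step n) ^+ 2 + sin (j%:R * step n) ^+ 2) = n%:R :> R.
  by rewrite (eq_bigr (fun=> 1)) ?sumr_const ?card_ord// => j _; rewrite cos2Dsin2.
have CC : \sum_(j < n) cos (j%:R * step n) * cos (j%:R * step n) = n%:R / 2 :> R.
  under eq_bigr do rewrite -expr2.
  move: C2 CS1; rewrite sumrB big_split /=; lra.
have SS : \sum_(j < n) sin (j%:R * step n) * sin (j%:R * step n) = n%:R / 2 :> R.
  under eq_bigr do rewrite -expr2.
  move: C2 CS1; rewrite sumrB big_split /=; lra.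
have cosT1E (g : nat -> R) : cosT n g 1 = \sum_(j < n) g j * cos (j%:R * step n) :> R.
  by apply: eq_bigr => j _; rewrite mul1r.
have sinT1E (g : nat -> R) : sinT n g 1 = \sum_(j < n) g j * sin (j%:R * step n) :> R.
  by apply: eq_bigr => j _; rewrite mul1r.
have lin (u : nat -> R) : \sum_(j < n) s' x j * u j =
    \sum_(j < n) s j x * u j - sigma x / n%:R * (\sum_(j < n) u j) -
    2 / n%:R * (cs x * (\sum_(j < n) cos (j%:R * step n) * u j) +
                sn x * (\sum_(j < n) sin (j%:R * step n) * u j)).
  rewrite !mulr_sumr -big_split mulr_sumr -!sumrB; apply: eq_bigr => j _.
  by rewrite /s' /=; ring.
split.
- transitivity (\sum_(j < n) s' x j * 1); first by apply: eq_bigr => j _; rewrite mulr1.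
  rewrite (lin (fun=> 1)) -!mulr_suml C1 S1 sumr_const card_ord -/(sigma x).
  by field; rewrite n0.
- rewrite cosT1E (lin (fun j => cos (j%:R * step n))) C1 SC CC /cs cosT1E.
  by field; rewrite n0.
- rewrite sinT1E (lin (fun j => sin (j%:R * step n))) S1 CS SS /sn sinT1E.
  by field; rewrite n0.
Qed.

Lemma projection_bigO j : bigO 2 (fun x => s' x j - s j x).
Proof.
have [csO snO] := cs_sn_bigO; have [_ /(@bigO_le 2 3 _ isT) sO] := area_sigma_bigO.
apply: bigO_ext (bigON _ _ (bigOD _ _ _ (bigOZ _ n%:R^-1 _ sO) (bigOZ _ (2 / n%:R) _
  (bigOD _ _ _ (bigOZ _ (cos (j%:R * step n)) _ csO)
               (bigOZ _ (sin (j%:R * step n)) _ snO))))) => x.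
by rewrite /s'; ring.
Qed.

Lemma projection_mul_bigO i j : bigO 3 (fun x => s' x i * s' x j - s i x * s j x).
Proof.
have s'O : bigO 1 (fun x => s' x j).
  apply: bigO_ext (bigOD _ _ _ (bigO_le 1 2 _ isT (projection_bigO j)) (s_bigO j)) => x.
  by rewrite subrK.
apply: bigO_ext (bigOD _ _ _ (bigOM _ _ _ _ (projection_bigO i) s'O)
  (bigOM _ _ _ _ (s_bigO i) (projection_bigO j))) => x.
ring.
Qed.

(** The area inequality requires the constraints exactly, so the area estimate is moved to the
    projection, the inequality is applied there, and the bound is moved back; each move costs only
    order three. *)
Lemma sqnorm_bigO : bigO 3 (fun x => \sum_(j < n) s j x ^+ 2).
Proof.
have [areaO _] := area_sigma_bigO.
have area'O : bigO 3 (fun x => \sum_(j < n) s' x j * support_number (step n) (s' x) j).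
  have D : bigO 3 (fun x => \sum_(j < n) \sum_(i < j)
      sin ((j%:R - i%:R) * step n) * (s' x j * s' x i - s j x * s i x)).
    apply: (bigO_sum _ _ (fun j x => \sum_(i < j)
      sin ((j%:R - i%:R) * step n) * (s' x j * s' x i - s j x * s i x))) => j _.
    apply: (bigO_sum _ _ (fun i x =>
      sin ((j%:R - i%:R) * step n) * (s' x j * s' x i - s j x * s i x))) => i _.
    exact: bigOZ (projection_mul_bigO j i).
  apply: bigO_ext (bigOD _ _ _ D areaO) => x.
  rewrite -big_split; apply: eq_bigr => j _.
  rewrite /support_number !mulr_sumr -big_split; apply: eq_bigr => i _ /=; ring.
have sd := @sin_step_gt0 R n n_gt2.
have sq'O : bigO 3 (fun x => \sum_(j < n) s' x j ^+ 2).
  have [C C0 HC] := area'O; exists (C * (4 / sin (step n))).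
    by rewrite mulr_ge0// divr_ge0// ltW.
  move=> x; have [z1 z2 z3] := projection_constraints x.
  have := @area_negative_definite R n (s' x) n_gt2 z1 z2 z3.
  have := HC x; set a := \sum_(_ < _) _; set b := \sum_(_ < _) _ => aC ab.
  have b0 : 0 <= b by apply: sumr_ge0 => j _; exact: sqr_ge0.
  rewrite ger0_norm// mulrAC mulrA ler_pdivlMr// mulrC.
  have : - a <= `|a| by rewrite ler_normr lexx orbT.
  by lra.
have D : bigO 3 (fun x => \sum_(j < n) (s' x j * s' x j - s j x * s j x)).
  apply: (bigO_sum _ _ (fun j x => s' x j * s' x j - s j x * s j x)) => j _.
  exact: projection_mul_bigO.
apply: bigO_ext (bigOB _ _ _ sq'O D) => x.
by rewrite -sumrB; apply: eq_bigr => j _; ring.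
Qed.

End SecondOrderRigidity.
End BigO.

(** * Genericity as nonvanishing of [planar_sqnorm] and [moment_z] *)

Section Genericity.
Variable R : realType.
Implicit Types w q : 'cV[R]_3.

Lemma planar_sqnorm_neq0 w : cross w (e_z R) != 0 -> planar_sqnorm w != 0.
Proof.
apply: contra_neq => w0.
have [a0 b0] : w 0 0 = 0 /\ w 1 0 = 0.
  move/eqP: w0; rewrite /planar_sqnorm paddr_eq0 ?sqr_ge0// !sqrf_eq0.
  by move=> /andP[/eqP -> /eqP ->].
by apply/matrixP => i j; rewrite !mxE a0 b0; case: i => [[|[|[|//]]] ?] /=; ring.
Qed.

(* If the moment about the z-axis vanishes then [q = t w] in the plane, and every axis
   passes through [(0, 0, - t w_z)]. *)
Lemma moment_z_neq0 n w q : q 2 0 = 0 -> generic_ngon n w q -> moment_z w q != 0.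
Proof.
move=> qz [/planar_sqnorm_neq0 w0 npencil]; apply/eqP => m0; apply: npencil.
pose t := planar_dot w q / planar_sqnorm w.
have qx : q 0 0 = t * w 0 0.
  apply: (mulIf w0).
  have -> : q 0 0 * planar_sqnorm w = planar_dot w q * w 0 0 + moment_z w q * w 1 0.
    by rewrite /planar_sqnorm /planar_dot /moment_z; ring.
  by rewrite m0 /t; field.
have qy : q 1 0 = t * w 1 0.
  apply: (mulIf w0).
  have -> : q 1 0 * planar_sqnorm w = planar_dot w q * w 1 0 - moment_z w q * w 0 0.
    by rewrite /planar_sqnorm /planar_dot /moment_z; ring.
  by rewrite m0 /t; field.
exists (- t * w 2 0) => i; rewrite /q_i /omega_i; set a := alpha R i.
have E k : (vec3 0 0 (- t * w 2 0) - Rz a *m q) k 0 = [:: 0; 0; - t * w 2 0]`_k - (Rz a *m q) k 0.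
  by rewrite !mxE.
apply/matrixP => k l; rewrite ord1 [RHS]mxE {l}.
case: k => [[|[|[|//]]] Hk]; rewrite mxE /= !E !Rz_mulE ?qx ?qy ?qz /=; ring.
Qed.

End Genericity.

(** * Isolation of the reference configuration *)

Lemma sin_small (R : realType) (d : R) : 0 < d ->
  exists2 r : R, 0 < r & forall t, `|t| < r -> `|sin t| < d.
Proof.
move=> d0.
have /cvgr_dist_lt : (sin x @[x --> (0 : R)] --> sin (0 : R))%classic by exact: continuous_sin.
move=> /(_ d d0)/nbhs_ballP[r r0 H]; exists r => // t tr.
have := H t; rewrite /ball /= sub0r normrN => /(_ tr).
by rewrite sin0 sub0r normrN.
Qed.

Theorem mainTheorem1 (R : realType) (n : nat) (w1 q1 : 'cV[R]_3) :
  (7 <= n)%N ->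
  regular_ngon_data w1 q1 ->
  generic_ngon n w1 q1 ->
  hypo_paradoxical (omega_i (n:=n) w1) (q_i (n:=n) q1).
Proof.
move=> n7 [w_unit q_z] gen; split; first by rewrite /CGK_mobility subr_gt0 ltz_nat.
have [/planar_sqnorm_neq0 planar_neq0 _] := gen.
have moment_neq0 := moment_z_neq0 _ _ _ _ q_z gen.
case: n n7 gen => // N n7 gen.
have n0 : 0 < N.+1%:R :> R by rewrite ltr0n.
have [r1 r1_gt0 Hr1] := @sin_small R (N.+1%:R^-1) ltac:(by rewrite invr_gt0).
pose C_space := config_space (omega_i (n:=N.+1) w1) (q_i (n:=N.+1) q1).
(* The estimates are uniform over a type, so the nearby closed configurations are packed into one.
   The bound [r1] ensures [e <= 1]; the bound [pi / 2] makes the cosines positive. *)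
pose T := {theta : 'I_N.+1 -> R |
  (forall i, `|theta i| < r1 /\ `|theta i| < pi / 2) /\ C_space theta}.
pose e (x : T) := Num.sqrt (\sum_(i < N.+1) sin (sval x i) ^+ 2).
have e_ge0 x : 0 <= e x by exact: sqrtr_ge0.
have e2 x : e x ^+ 2 = \sum_(i < N.+1) sin (sval x i) ^+ 2.
  by rewrite sqr_sqrtr// sumr_ge0// => i _; exact: sqr_ge0.
have e_bound x d : 0 <= d -> (forall i, `|sin (sval x i)| <= d) -> e x <= N.+1%:R * d.
  move=> d0 H; rewrite -ler_sqr ?nnegrE ?mulr_ge0 ?(ltW n0)// e2.
  apply: (@le_trans _ _ (\sum_(i < N.+1) d ^+ 2)).
    apply: ler_sum => i _; rewrite -real_normK ?num_real//.
    by rewrite ler_sqr ?nnegrE.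
  rewrite sumr_const card_ord -[_ *+ _]mulr_natl exprMn ler_wpM2r ?sqr_ge0//.
  by rewrite expr2 ler_peMl ?(ltW n0)// ler1n.
have e_le1 x : e x <= 1.
  rewrite -(mulfV (lt0r_neq0 n0)); apply: e_bound; first by rewrite invr_ge0 ltW.
  by move=> i; rewrite ltW// Hr1//; have [/(_ i)[]] := svalP x.
(* Out of range, [inord] falls back to joint [0], so the bounds below hold for every natural
   index. *)
pose s j (x : T) := sin (sval x (inord j)).
pose c j (x : T) := 1 - cos (sval x (inord j)).
have s_le j x : `|s j x| <= e x.
  rewrite -ler_sqr ?nnegrE// e2 real_normK ?num_real// /s (bigD1 (inord j))//=.
  by rewrite lerDl sumr_ge0// => i _; exact: sqr_ge0.
have s_bigO j : bigO R T e 1 (s j) by exists 1 => // x; rewrite expr1 mul1r.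
have c_bigO j : bigO R T e 3 (fun x => c j x - s j x ^+ 2 / 2).
  exists 1 => // x; rewrite mul1r.
  have : 0 < cos (sval x (inord j)).
    by apply: cos_gt0_pihalf; rewrite -ltr_norml; have [/(_ (inord j))[]] := svalP x.
  have := s_le j x; have := cos_le1 (sval x (inord j)); have := cos2Dsin2 (sval x (inord j)).
  have := e_ge0 x; have := e_le1 x; rewrite /c /s.
  move: (e x) (cos _) (sin _) => E u v E1 E0 uv u1 vE u0.
  (* As [u > 0], [1 - u <= (1 - u) (1 + u) = v^2 <= E^2], so the error is in fact of fourth
     order. *)
  have -> : 1 - u - v ^+ 2 / 2 = (1 - u) ^+ 2 / 2.
    have -> : v ^+ 2 = 1 - u ^+ 2 by rewrite -uv; ring.
    by field.
  rewrite ger0_norm ?divr_ge0 ?sqr_ge0//.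
  have v2 : v ^+ 2 <= E ^+ 2 by rewrite -real_normK ?num_real// ler_sqr ?nnegrE.
  have uE : 1 - u <= E ^+ 2 by nra.
  have u2E : (1 - u) ^+ 2 <= (E ^+ 2) ^+ 2 by rewrite ler_sqr ?nnegrE ?sqr_ge0 ?subr_ge0.
  have E43 : (E ^+ 2) ^+ 2 <= E ^+ 3 by rewrite -exprM ler_wiXn2l.
  have : 0 <= E ^+ 3 by exact: exprn_ge0.
  by lra.
have closure x : \prod_(i < N.+1) (1 + s i x *: rotated_twist w1 q1 (i%:R * step N.+1) +
    c i x *: rotated_twist w1 q1 (i%:R * step N.+1) ^+ 2) = 1.
  have [_ Hx] := svalP x; rewrite -[RHS]Hx /loop_map; apply: eq_bigr => i _.
  rewrite expm_rodrigues; last by apply: revolute_twist_cube; rewrite sqnorm_Rz.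
  have -> : revolute_twist (omega_i w1 i) (q_i q1 i) = rotated_twist w1 q1 (i%:R * step N.+1).
    rewrite /rotated_twist /omega_i /q_i.
    have -> : alpha R i = i%:R * step N.+1 by rewrite /alpha /step; ring.
    by [].
  by rewrite /s /c inord_val.
have n2 : (2 < N.+1)%N by lia.
have [C C0 HC] := sqnorm_bigO R T e e_ge0 e_le1 N.+1 w1 q1 s c n2 q_z
  moment_neq0 planar_neq0 s_bigO c_bigO closure.
have C1 : 0 < C + 1 by rewrite ltr_wpDl.
(* Chosen so that [e x <= 1 / (C + 1)], whence [C * e x < 1]; then [e^2 <= C e^3] forces
   [e x = 0]. *)
have [r2 r2_gt0 Hr2] := @sin_small R (N.+1%:R^-1 / (C + 1)) ltac:(by rewrite divr_gt0 ?invr_gt0).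
exists (Num.min (Num.min r1 (pi / 2)) r2).
  by rewrite !lt_min r1_gt0 r2_gt0 divr_gt0 ?pi_gt0.
move=> theta small; rewrite inE => Ctheta i.
have smallT : forall i, `|theta i| < r1 /\ `|theta i| < pi / 2.
  by move=> k; have := small k; rewrite !lt_min => /andP[/andP[-> ->]].
pose x : T := exist _ theta (conj smallT Ctheta).
have ex_small : e x <= (C + 1)^-1.
  have -> : (C + 1)^-1 = N.+1%:R * (N.+1%:R^-1 / (C + 1)).
    by rewrite mulrA mulfV ?mul1r ?lt0r_neq0.
  apply: e_bound.
    by rewrite ltW// divr_gt0 ?invr_gt0.
  by move=> k; rewrite ltW// Hr2//=; have := small k; rewrite !lt_min => /andP[].
have ex0 : e x = 0.
  apply/eqP/negPn/negP => ex_neq0.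
  have ex_gt0 : 0 < e x by rewrite lt0r ex_neq0 e_ge0.
  have := HC x.
  rewrite (eq_bigr (fun i => sin (sval x i) ^+ 2)) => [|k _]; last by rewrite /s inord_val.
  rewrite -e2 ger0_norm ?sqr_ge0// => He.
  have Ce : C * e x < 1.
    move: ex_small; rewrite -[leRHS]mul1r ler_pdivlMr// mulrDr mulr1 [e x * C]mulrC.
    by apply: lt_le_trans; rewrite ltrDl.
  have : 0 < e x ^+ 2 * (1 - C * e x) by rewrite mulr_gt0 ?exprn_gt0 ?subr_gt0.
  have -> : e x ^+ 2 * (1 - C * e x) = e x ^+ 2 - C * e x ^+ 3 by ring.
  by rewrite subr_gt0 ltNge He.
have sin0i : sin (theta i) = 0.
  by have := s_le i x; rewrite ex0 /s inord_val normr_le0 => /eqP.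
have [_ hpi] := smallT i; move: hpi; rewrite ltr_norml => /andP[/ltW h1 /ltW h2].
have p0 : 0 <= (pi : R) / 2 by rewrite divr_ge0 ?pi_ge0.
apply: sin_inj; rewrite ?in_itv /= ?h1 ?h2 ?oppr_le0 ?p0//.
by rewrite sin0i sin0.
Qed.
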